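(* Let $L$ be a non-empty countable relational language, let $T$ be a first order theory in $L$, and let $F$ be any countable fragment of $L_{\omega_1\omega}$. If there is an uncountable set of countably infinite models of $T$ (that is, an uncountable set of $x\in X_L$ with $\mathcal{U}_x\models T$) that are pairwise separable in $F$, then there is a set of countably infinite models of $T$ of size $2^{\aleph_0}$ that are pairwise separable in $F$ (and so $T$ has $2^{\aleph_0}$ pairwise non-isomorphic countable models).
   Context: $L=(R_i)_{i\in I}$ is a non-empty countable relational language, where $I$ is a non-empty countable index set and $R_i$ is an $n_i$-ary relation symbol. Put $X_L=\prod_{i\in I}2^{(\mathbb{N}^{n_i})}$, viewed as the space of countably infinite $L$-structures: each $x\in X_L$ codes the $L$-structure $\mathcal{U}_x$ with universe $\mathbb{N}$ in which $R_i$ is interpreted by the relation whose characteristic function is $x(i)$. $L_{\omega_1\omega}$ is the usual infinitary logic (countable conjunctions and disjunctions, finite quantifier strings); formulas have finitely many free variables. For a formula $\varphi$, $\Delta\varphi$ denotes its (finite) set of free variables, and ${}^{|\Delta\varphi|}\omega$ is the set of sequences of natural numbers of length $|\Delta\varphi|$ (here $\omega=\mathbb{N}$). A fragment $F$ of $L_{\omega_1\omega}$ is a set of formulas of $L_{\omega_1\omega}$ containing all atomic formulas and closed under subformulas, negation, quantifiers, and finite conjunctions and disjunctions. For $x\in X_L$ and a formula $\varphi$, let $\varphi^x=\{\bar s\in{}^{|\Delta\varphi|}\omega:\mathcal{U}_x\models\varphi[\bar s]\}$, where $\varphi[\bar s]$ is obtained by substituting $\bar s$ for the free variables of $\varphi$.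 If $\varphi$ is a sentence, $\varphi^x$ is either empty or contains only the empty sequence. Two elements $x,y\in X_L$ (or their corresponding structures $\mathcal{U}_x,\mathcal{U}_y$) are separable in $F$ if there is $\varphi\in F$ such that $|\varphi^x|\neq|\varphi^y|$. *)

(* Defs.v *)
From HB Require Import structures.
From mathcomp Require Import all_boot finmap.
From mathcomp Require Import boolp classical_sets functions cardinality.

Set Implicit Arguments.
Unset Strict Implicit.
Unset Printing Implicit Defensive.

Local Open Scope classical_set_scope.
Local Open Scope card_scope.

(* A countable relational language; [countType] covers finite index types. *)
Record language := Language { symb : countType; arity : symb -> nat }.

(* Index types of countable families: 'I_n for the families of length n, nat
   for the countably infinite ones. *)
Definition index_of (k : option nat) : Type :=
  if k is Some n then 'I_n else nat.

(* Variables are natural numbers: v_0, v_1, ... *)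
Inductive form (L : language) : Type :=
| FEq (v w : nat)
| FRel (i : symb L) (vs : (arity i).-tuple nat)
| FNeg (phi : form L)
| FConj (k : option nat) (f : index_of k -> form L)
| FDisj (k : option nat) (f : index_of k -> form L)
| FEx (v : nat) (phi : form L)
| FAll (v : nat) (phi : form L).

Arguments FEq {L} v w.
Arguments FRel {L} i vs.

Section Syntax.
Context {L : language}.
Implicit Types (phi : form L) (F T : set (form L)).

Fixpoint free_vars phi : set nat :=
  match phi with
  | FEq v w => [set v; w]
  | FRel _ vs => [set v | v \in val vs]
  | FNeg psi => free_vars psi
  | FConj _ f | FDisj _ f => \bigcup_j free_vars (f j)
  | FEx v psi | FAll v psi => free_vars psi `\ v
  end.

(* [form L] allows infinitely many free variables; L_{omega_1 omega} does not. *)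
Definition Lw1w : set (form L) := [set phi | finite_set (free_vars phi)].

Definition sentence phi : Prop := free_vars phi = set0.

Fixpoint subformulas phi : set (form L) :=
  phi |` match phi with
         | FEq _ _ | FRel _ _ => set0
         | FNeg psi | FEx _ psi | FAll _ psi => subformulas psi
         | FConj _ f | FDisj _ f => \bigcup_j subformulas (f j)
         end.

Fixpoint first_order phi : Prop :=
  match phi with
  | FEq _ _ | FRel _ _ => True
  | FNeg psi | FEx _ psi | FAll _ psi => first_order psi
  | FConj k f | FDisj k f => k <> None /\ forall j, first_order (f j)
  end.

Definition first_order_theory T : Prop :=
  forall phi, T phi -> first_order phi /\ sentence phi.

(* The empty conjunction and disjunction are allowed in a fragment but not
   required to belong to it. *)
Record fragment F : Prop := Fragment {
  fragment_Lw1w : F `<=` Lw1w;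
  fragment_eq : forall v w, F (FEq v w);
  fragment_rel : forall i vs, F (FRel i vs);
  fragment_sub : forall phi, F phi -> subformulas phi `<=` F;
  fragment_neg : forall phi, F phi -> F (FNeg phi);
  fragment_ex : forall v phi, F phi -> F (FEx v phi);
  fragment_all : forall v phi, F phi -> F (FAll v phi);
  fragment_conj : forall n (f : 'I_n -> form L), 0 < n ->
    (forall j, F (f j)) -> F (@FConj L (Some n) f);
  fragment_disj : forall n (f : 'I_n -> form L), 0 < n ->
    (forall j, F (f j)) -> F (@FDisj L (Some n) f)
}.

End Syntax.

(* The space X_L of L-structures with universe nat. *)
Definition structures (L : language) : Type :=
  forall i : symb L, (arity i).-tuple nat -> bool.

Section Semantics.
Context {L : language}.
Implicit Types (x y : structures L) (phi : form L) (F T : set (form L)).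

Fixpoint sat x phi (e : nat -> nat) : Prop :=
  match phi with
  | FEq v w => e v = e w
  | FRel i vs => x i (map_tuple e vs)
  | FNeg psi => ~ sat x psi e
  | FConj _ f => forall j, sat x (f j) e
  | FDisj _ f => exists j, sat x (f j) e
  | FEx v psi => exists a : nat, sat x psi [eta e with v |-> a]
  | FAll v psi => forall a : nat, sat x psi [eta e with v |-> a]
  end.

Definition models x T : Prop := forall phi, T phi -> forall e, sat x phi e.

(* The free variables in increasing order; meaningful for phi in Lw1w only,
   since [fset_set] sends infinite sets to the empty one. *)
Definition free_var_seq phi : seq nat := sort leq (fset_set (free_vars phi)).

(* The j-th free variable is sent to the j-th entry of s; the default value 0
   is only used at variables that are not free in phi. *)
Definition assignment phi (s : seq nat) : nat -> nat :=
  fun v => nth 0 s (index v (free_var_seq phi)).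

Definition extension phi x : set ((size (free_var_seq phi)).-tuple nat) :=
  [set s | sat x phi (assignment phi s)].

Arguments extension : clear implicits.

Definition separable F x y : Prop :=
  exists2 phi, F phi & ~ (extension phi x #= extension phi y).

Definition isomorphic x y : Prop :=
  exists2 g : nat -> nat, bijective g &
    forall i (s : (arity i).-tuple nat), x i s = y i (map_tuple g s).

Definition pairwise_on (R : structures L -> structures L -> Prop)
    (S : set (structures L)) : Prop :=
  forall x y, S x -> S y -> x <> y -> R x y.

End Semantics.

Definition continuum_sized (U : Type) (S : set U) : Prop :=
  S #= [set: nat -> bool].

(* Main.v *)
(* Let G be F together with all first-order formulas.  Code a structure by its
   answers to countably many questions: does a given formula of G hold at a given
   assignment, with a witness for whichever existential statement is then true,
   and is the set it defines contained in a given finite set.  A limit of codes of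
   models of T is again read off a model of T, because the truth definition of each
   formula only compares two answers at a time (this is where witnesses are used).
   If |phi^x| <> |phi^y|, then finitely many answers show that one of the two sets
   has at most n elements and the other more than n, so separability is an open
   condition on limits of codes.  The Cantor-Bendixson argument applied to the
   codes of an uncountable pairwise separable set therefore yields a Cantor scheme
   whose branches are pairwise separable models of T. *)
Require Import Defs.
From HB Require Import structures.
From mathcomp Require Import all_boot finmap.
From mathcomp Require Import boolp classical_sets functions cardinality.

Set Implicit Arguments.
Unset Strict Implicit.
Unset Printing Implicit Defensive.

Local Open Scope classical_set_scope.
Local Open Scope card_scope.

(** * Condensation points and a Cantor scheme in [Q -> A] *)

Lemma countable_setU (T : Type) (A B : set T) :
  countable A -> countable B -> countable (A `|` B).
Proof.
move=> cA cB.
have cAB (b : bool) : [set: bool] b -> countable (if b then A else B).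
  by case: b.
apply: sub_countable (bigcup_countable (@countableP _ setT) cAB).
by apply: subset_card_le => x [Ax|Bx]; [exists true|exists false].
Qed.

(** For fixed [z] this is a basic neighbourhood in the product topology with [A] discrete; [n]
    serves as its radius, a larger [n] giving a smaller neighbourhood. *)
Definition agree (Q : countType) (A : Type) (n : nat) (z w : Q -> A) : Prop :=
  forall q : Q, choice.pickle q < n -> z q = w q.

Definition closure_points (Q : countType) (A : Type) (B : set (Q -> A)) :
    set (Q -> A) :=
  [set z | forall n, exists2 x, B x & agree n x z].

Lemma agree_trans (Q : countType) (A : Type) n (x y z : Q -> A) :
  agree n x y -> agree n y z -> agree n x z.
Proof. by move=> xy yz q qn; rewrite xy// yz. Qed.

Lemma agree_le (Q : countType) (A : Type) m n (x y : Q -> A) :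
  m <= n -> agree n x y -> agree m x y.
Proof. by move=> mn xy q qm; apply/xy/(leq_trans qm). Qed.

Definition condensation (Q : countType) (A : Type) (B : set (Q -> A)) :
    set (Q -> A) :=
  [set x | B x /\ forall n, ~ countable (B `&` agree n x)].

(** Each point removed has a basic neighbourhood meeting [B] in a countable set, and there are only
    countably many basic neighbourhoods. *)
Lemma countable_diff_condensation (Q A : countType) (B : set (Q -> A)) :
  countable (B `\` condensation B).
Proof.
(* [pickle_inv] is [None] at numbers coding no point of [Q]; traces thus live in a countable type
   and index the neighbourhoods. *)
pose trace n (x : Q -> A) : seq (option A) :=
  [seq omap x (@pickle_inv Q k) | k <- iota 0 n].
have traceP n x y : trace n x = trace n y -> agree n x y.
  move=> /eq_in_map xy q qn.
  by have := xy (choice.pickle q); rewrite mem_iota /= pickleK_inv => /(_ qn) [].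
pose C (p : nat * seq (option A)) : set (Q -> A) :=
  if pselect (countable (B `&` [set y | trace p.1 y = p.2]))
  then B `&` [set y | trace p.1 y = p.2] else set0.
have cC p : [set: nat * seq (option A)] p -> countable (C p).
  by move=> _; rewrite /C; case: pselect => // ?; apply: countable0.
apply: sub_countable (bigcup_countable (@countableP _ setT) cC).
apply: subset_card_le => x [Bx].
move=> /not_andP[//|/existsNP[n /contrapT cn]].
exists (n, trace n x) => //; rewrite /C; case: pselect => // -[] /=.
apply: sub_countable cn; apply: subset_card_le => y [By /= xy].
by split=> //; apply: traceP.
Qed.

(** Otherwise some neighbourhood of [x] in [B] would contain only [x] and non-condensation points,
    hence be countable. *)
Lemma condensation_split (Q A : countType) (B : set (Q -> A)) x n :
  condensation B x ->
  exists2 y, condensation B y & x <> y /\ agree n x y.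
Proof.
move=> [Bx xB]; apply: contrapT => noy; apply: (xB n).
have cx : countable [set x] := finite_set_countable (finite_set1 x).
apply: sub_countable (countable_setU cx (countable_diff_condensation B)).
apply: subset_card_le => y [By xy].
have [->|yx] := pselect (y = x); [by left|right; split=> // cy].
by apply: noy; exists y => //; split=> // e; apply: yx.
Qed.

(* The last hypothesis says that [R] is open on the closure of [B]. The proof runs
   a Cantor scheme whose nodes are condensation points of [B] paired with the
   radius of a neighbourhood. *)
Lemma perfect_set (Q A : countType) (B : set (Q -> A))
    (R : (Q -> A) -> (Q -> A) -> Prop) :
  ~ countable B -> (forall z w, R z w -> R w z) ->
  (forall x y, B x -> B y -> x <> y ->
     exists n, forall z w, closure_points B z -> closure_points B w ->
       agree n x z -> agree n y w -> R z w) ->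
  exists h : (nat -> bool) -> (Q -> A),
    (forall b, closure_points B (h b)) /\ forall b c, b <> c -> R (h b) (h c).
Proof.
move=> uB symR openR.
have [x0 Bx0] : exists x, condensation B x.
  apply: contrapT => noB; apply: uB.
  apply: sub_countable (countable_diff_condensation B).
  by apply: subset_card_le => x Bx; split=> // Cx; apply: noB; exists x.
(* One child of [p] keeps the point [p.1], the other moves to [r.1]; both get radius [r.2], large
   enough for [R] to hold between their neighbourhoods. *)
pose split_spec (p : (Q -> A) * nat) (r : (Q -> A) * nat) :=
  condensation B p.1 -> [/\ condensation B r.1, agree p.2 p.1 r.1, p.2 < r.2 &
    forall z w, closure_points B z -> closure_points B w ->
      agree r.2 p.1 z -> agree r.2 r.1 w -> R z w].
have [next nextP] : {f & forall p, split_spec p (f p)}.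
  apply: choice => -[x n]; case: (pselect (condensation B x)); last first.
    by move=> nx; exists (x, n).
  move=> Cx; have [y Cy [neq xy]] := condensation_split n Cx.
  have [m mR] := openR x y Cx.1 Cy.1 neq.
  exists (y, (maxn m n.+1)) => _; split=> //=.
    by rewrite leq_max leqnn orbT.
  move=> z w Bz Bw xz yw; apply: mR => //.
    exact: agree_le (leq_maxl _ _) xz.
  exact: agree_le (leq_maxl _ _) yw.
pose node (b : nat -> bool) := fix node k : (Q -> A) * nat :=
  if k is k'.+1 then
    (if b k' then (next (node k')).1 else (node k').1, (next (node k')).2)
  else (x0, 0).
have nodeC b k : condensation B (node b k).1.
  by elim: k => //= k IH; case: (b k) => //; have [] := nextP _ IH.
have node_lt b k : (node b k).2 < (node b k.+1).2.
  by have [] := nextP _ (nodeC b k).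
have node_ge b k : k <= (node b k).2.
  by elim: k => // k IH; apply: leq_ltn_trans IH (node_lt b k).
have node_agree b k m : k <= m ->
    agree (node b k).2 (node b k).1 (node b m).1 /\ (node b k).2 <= (node b m).2.
  elim: m => [|m IH]; first by rewrite leqn0 => /eqP ->.
  rewrite leq_eqVlt => /predU1P[->//|/IH[km le_km]]; split; last first.
    exact: leq_trans le_km (ltnW (node_lt b m)).
  apply: agree_trans km _; apply: agree_le le_km _ => /=.
  by case: (b m) => //; have [] := nextP _ (nodeC b m).
(* The radius at level [(pickle q).+1] exceeds [pickle q], so the value at [q] no longer changes
   from there on. *)
pose h b : Q -> A := fun q => (node b (choice.pickle q).+1).1 q.
have h_agree b k : agree (node b k).2 (node b k).1 (h b).
  move=> q qk; rewrite /h; have [le_kq|lt_qk] := leqP k (choice.pickle q).+1.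
    by have [-> //] := node_agree b k _ le_kq.
  have [lt_agree _] := node_agree b _ _ (ltnW lt_qk).
  by symmetry; apply/lt_agree/(node_ge b (choice.pickle q).+1).
have hB b : closure_points B (h b).
  move=> n; exists (node b n).1; first by have [] := nodeC b n.
  exact: agree_le (node_ge b n) (h_agree b n).
exists h; split=> // b c bc.
have /existsNP/cid[k0 /eqP k0bc] : ~ forall k, b k = c k.
  by move=> e; apply/bc/funext.
(* At the first difference the two branches leave a common node for its two children; [split_spec]
   gives [R] from the kept point to the new one, and symmetry the other order. *)
case: (ex_minnP (ex_intro (fun k => b k != c k) k0 k0bc)) => k kbc kmin.
have ebc m : m <= k -> node b m = node c m.
  elim: m => //= m IH mk; rewrite IH 1?ltnW//.
  suff -> : b m = c m by [].
  by apply/eqP; apply: contraLR mk => /kmin; rewrite -leqNgt.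
have Rk b' c' : node b' k = node c' k -> b' k = false -> c' k = true ->
    R (h b') (h c').
  move=> e bk ck; have [_ _ _ ] := nextP _ (nodeC b' k); apply=> //.
    by have := h_agree b' k.+1; rewrite /= bk.
  by have := h_agree c' k.+1; rewrite /= ck -e.
case bk: (b k); case ck: (c k); move: kbc; rewrite bk ck // => _.
  by apply: symR; apply: Rk => //; rewrite ebc.
by apply: Rk => //; rewrite ebc.
Qed.

(** * Finite certificates for different cardinalities *)

Definition few_vs_many (U : eqType) (E E' : set U) : Prop :=
  exists l l' : seq U, [/\ uniq l', size l < size l',
    E `<=` [set` l] & [set` l'] `<=` E'].

Lemma few_vs_many_neq (U : choiceType) (E E' : set U) :
  few_vs_many E E' -> ~ (E #= E').
Proof.
move=> [l [l' [ul' ll' El l'E']]] EE'; move: ll'.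
have fE : finite_set E by apply: sub_finite_set El (finite_seq l).
have fE' : finite_set E' by rewrite -(eq_finite_set EE').
have /(fcard_eq fE fE') eqE := EE'.
rewrite ltnNge => /negP; apply.
apply: (@leq_trans (size (fset_set E'))).
  by apply: uniq_leq_size => // u /l'E' E'u; rewrite in_fset_set// in_setE.
rewrite -[size _]/(#|` _|) -eqE uniq_leq_size// ?fset_uniq// => u.
by rewrite in_fset_set// in_setE => /El.
Qed.

(** Infinite subsets of a countable type are equinumerous, so at least one of the two sets is
    finite. *)
Lemma neq_few_vs_many (U : countType) (E E' : set U) :
  ~ (E #= E') -> few_vs_many E E' \/ few_vs_many E' E.
Proof.
have inf_few (A B : set U) : finite_set A -> infinite_set B -> few_vs_many A B.
  move=> /finite_seqP[l ->] /(infinite_set_fset (size l).+1)[X XB lX].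
  by exists l, X; split; rewrite ?fset_uniq.
have fin_few (A B : set U) : finite_set A -> finite_set B ->
    (#|` fset_set A| < #|` fset_set B|)%N -> few_vs_many A B.
  move=> fA fB AB; exists (fset_set A), (fset_set B); split=> //.
  - exact: fset_uniq.
  - by move=> u Au /=; rewrite in_fset_set// in_setE.
  - by move=> u /=; rewrite in_fset_set// in_setE.
move=> neq; have [fE|iE] := pselect (finite_set E).
  have [fE'|iE'] := pselect (finite_set E'); last by left; apply: inf_few.
  case: (ltngtP #|` fset_set E| #|` fset_set E'|)=> [lt|lt|/(fcard_eq fE fE')//].
    by left; apply: fin_few.
  by right; apply: fin_few.
have [fE'|iE'] := pselect (finite_set E'); first by right; apply: inf_few.
case: neq; apply: card_eq_trans (eq_card_nat (@countableP _ _) iE) _.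
by rewrite card_eq_sym; apply: eq_card_nat (@countableP _ _) iE'.
Qed.

(** * Witnesses, and invariance of satisfaction *)

Section Formulas.
Context {L : language}.
Implicit Types (x y : structures L) (phi : form L).

Definition index_code (k : option nat) : index_of k -> nat :=
  match k return index_of k -> nat with
  | Some n => fun j : 'I_n => j
  | None => id
  end.

Lemma index_code_inj k : injective (@index_code k).
Proof. by case: k => [n|] j j' //= /ord_inj. Qed.

(* [w] codes a witness of whichever existential statement (that [phi] holds, or
   that it fails) is true at [e]. *)
Definition witnessed x phi e (w : nat) : Prop :=
  match phi with
  | FConj _ f => sat x phi e \/ exists2 j, index_code j = w & ~ sat x (f j) e
  | FDisj _ f => ~ sat x phi e \/ exists2 j, index_code j = w & sat x (f j) e
  | FEx v psi => ~ sat x phi e \/ sat x psi [eta e with v |-> w]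
  | FAll v psi => sat x phi e \/ ~ sat x psi [eta e with v |-> w]
  | _ => True
  end.

Lemma witnessed_ex x phi e : exists w, witnessed x phi e w.
Proof.
case: phi => [v u|i vs|psi|k f|k f|v psi|v psi] /=; try by exists 0.
- have [h|/existsNP[j nj]] := pselect (forall j, sat x (f j) e).
    by exists 0; left.
  by exists (index_code j); right; exists j.
- have [[j fj]|h] := pselect (exists j, sat x (f j) e); last by exists 0; left.
  by exists (index_code j); right; exists j.
- have [[w fw]|h] := pselect (exists w, sat x psi [eta e with v |-> w]).
    by exists w; right.
  by exists 0; left.
- have [h|/existsNP[w nw]] := pselect (forall w, sat x psi [eta e with v |-> w]).
    by exists 0; left.
  by exists w; right.
Qed.

Definition witness x phi e : nat := xget 0 (witnessed x phi e).

Lemma witnessP x phi e : witnessed x phi e (witness x phi e).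
Proof. by apply: (@xgetPex _ 0 (witnessed x phi e)); apply: witnessed_ex. Qed.

Lemma subformulas_refl phi : subformulas phi phi.
Proof. by case: phi => *; left. Qed.

Lemma first_order_subformulas phi :
  first_order phi -> subformulas phi `<=` first_order.
Proof.
elim: phi => [v w|i vs|psi IH|k f IH|k f IH|v psi IH|v psi IH] /= fo chi.
1,2: by move=> [->|].
- by case=> [->//|]; apply: IH.
- by case=> [->//|[j _]]; apply: IH; apply: fo.2.
- by case=> [->//|[j _]]; apply: IH; apply: fo.2.
- by case=> [->//|]; apply: IH.
- by case=> [->//|]; apply: IH.
Qed.

Lemma sat_ext x phi e e' :
  (forall v, free_vars phi v -> e v = e' v) -> sat x phi e <-> sat x phi e'.
Proof.
elim: phi e e' => [v w|i vs|psi IH|k f IH|k f IH|v psi IH|v psi IH] e e' /= ee'.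
- by rewrite !ee'//; [right|left].
- suff -> : map_tuple e vs = map_tuple e' vs by [].
  by apply/val_inj/eq_in_map => v /ee'.
- by rewrite (IH _ _ ee').
- have {}IH j : sat x (f j) e <-> sat x (f j) e'.
    by apply: IH => v fv; apply: ee'; exists j.
  by split=> h j; apply/IH/h.
- have {}IH j : sat x (f j) e <-> sat x (f j) e'.
    by apply: IH => v fv; apply: ee'; exists j.
  by split=> -[j h]; exists j; apply/IH.
- have {}IH a : sat x psi [eta e with v |-> a] <-> sat x psi [eta e' with v |-> a].
    by apply: IH => u fu /=; case: eqP => // uv; apply: ee'.
  by split=> -[a h]; exists a; apply/IH.
- have {}IH a : sat x psi [eta e with v |-> a] <-> sat x psi [eta e' with v |-> a].
    by apply: IH => u fu /=; case: eqP => // uv; apply: ee'.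
  by split=> h a; apply/IH/h.
Qed.

Lemma mem_free_var_seq phi v :
  Lw1w phi -> (v \in free_var_seq phi) = (v \in free_vars phi).
Proof. by move=> fin; rewrite mem_sort in_fset_set. Qed.

(** Injectivity of [g] serves the equality case, surjectivity the quantifiers. *)
Lemma sat_comp x y (g : nat -> nat) phi e : bijective g ->
  (forall i (s : (arity i).-tuple nat), x i s = y i (map_tuple g s)) ->
  sat x phi e <-> sat y phi (g \o e).
Proof.
move=> bg xy; have [h gh hg] := bg.
have upd e' v a :
    g \o [eta e' with v |-> a] = [eta g \o e' with v |-> g a].
  by apply/funext => u /=; case: eqP.
elim: phi e => [v w|i vs|psi IH|k f IH|k f IH|v psi IH|v psi IH] e /=.
- by split=> [->//|/(bij_inj bg)].
- rewrite xy; suff -> : map_tuple g (map_tuple e vs) = map_tuple (g \o e) vs by [].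
  by apply/val_inj; rewrite /= map_comp.
- by rewrite IH.
- by split=> H j; apply/IH/H.
- by split=> -[j H]; exists j; apply/IH.
- split=> [[a /IH]|[a H]]; first by rewrite upd; exists (g a).
  by exists (h a); apply/IH; rewrite upd hg.
- split=> H a; last by apply/IH; rewrite upd; apply: H.
  by have /IH := H (h a); rewrite upd hg.
Qed.

(** An isomorphism maps one extension bijectively onto the other; hence separable structures are not
    isomorphic. *)
Lemma isomorphic_extension x y phi : Lw1w phi -> isomorphic x y ->
  @extension L phi x #= @extension L phi y.
Proof.
move=> fin [g bg xy].
have extE (t : (size (free_var_seq phi)).-tuple nat) :
    @extension L phi x t <-> @extension L phi y (map_tuple g t).
  rewrite /extension /= (sat_comp _ _ bg xy); apply: sat_ext => v.
  rewrite -in_setE -mem_free_var_seq// => vphi.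
  by rewrite /assignment /= (nth_map 0)// size_tuple index_mem.
have -> : @extension L phi y = [set map_tuple g t | t in @extension L phi x].
  have [h gh hg] := bg.
  apply/seteqP; split=> [t|_ [t xt <-]]; last exact/extE.
  have e : map_tuple g (map_tuple h t) = t.
    by apply/val_inj; rewrite /= mapK.
  by rewrite -[in X in X -> _]e => /extE; exists (map_tuple h t).
rewrite card_eq_sym; apply: inj_card_eq => s t _ _ /(congr1 val) /=.
by move/(inj_map (bij_inj bg))/val_inj.
Qed.

(** The size bound sends every variable outside [free_var_seq phi] to the default [0], so a finite
    sequence describes the assignment. This lets the questions form a countable type. *)
Lemma assignment_nth phi (t : seq nat) :
  size t <= size (free_var_seq phi) -> exists s, assignment phi t = nth 0 s.
Proof.
move=> st; pose N := \max_(v <- free_var_seq phi) v.+1.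
exists (mkseq (assignment phi t) N); apply/funext => v.
have [vN|Nv] := ltnP v N; first by rewrite nth_mkseq.
rewrite [RHS]nth_default ?size_mkseq// /assignment nth_default//.
rewrite (leq_trans st)// leqNgt index_mem; apply: contraL Nv => vphi.
by rewrite -ltnNge /N; apply: (@leq_bigmax_seq _ _ xpredT succn).
Qed.

End Formulas.

(** * Countability of the set of first-order formulas *)

Definition finite_family_seq (T : Type) (k : option nat) :
    (index_of k -> T) -> seq T :=
  match k return (index_of k -> T) -> seq T with
  | Some n => fun f => [seq f j | j : 'I_n]
  | None => fun=> [::]
  end.

(* Injective on first-order formulas only: the members of an infinite conjunction
   or disjunction are dropped. *)
Fixpoint form_code (L : language) (phi : form L) : GenTree.tree nat :=
  match phi with
  | FEq v w => GenTree.Node 0 [:: GenTree.Leaf v; GenTree.Leaf w]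
  | FRel i vs => GenTree.Node 1 [seq GenTree.Leaf v | v <- choice.pickle i :: vs]
  | FNeg psi => GenTree.Node 2 [:: form_code psi]
  | FConj _ f => GenTree.Node 3 (finite_family_seq (fun j => form_code (f j)))
  | FDisj _ f => GenTree.Node 4 (finite_family_seq (fun j => form_code (f j)))
  | FEx v psi => GenTree.Node 5 [:: GenTree.Leaf v; form_code psi]
  | FAll v psi => GenTree.Node 6 [:: GenTree.Leaf v; form_code psi]
  end.

Lemma form_code_inj (L : language) (phi psi : form L) :
  first_order phi -> first_order psi -> form_code phi = form_code psi ->
  phi = psi.
Proof.
have leaf_inj : injective (@GenTree.Leaf nat) by move=> a b [].
(* The two index types are not known to be equal beforehand, so families are compared as dependent
   pairs. *)
have family_inj k k' (f : index_of k -> form L) (f' : index_of k' -> form L) :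
    (forall j chi, first_order (f j) -> first_order chi ->
       form_code (f j) = form_code chi -> f j = chi) ->
    k <> None /\ (forall j, first_order (f j)) ->
    k' <> None /\ (forall j, first_order (f' j)) ->
    finite_family_seq (fun j => form_code (f j)) =
      finite_family_seq (fun j => form_code (f' j)) ->
    existT (fun k => index_of k -> form L) k f = existT _ k' f'.
  case: k f => [n|] f IH [] // _ fo; case: k' f' => [n'|] f' [] // _ fo' /= e.
  have nn' : n = n' by have := congr1 size e; rewrite !size_image !card_ord.
  subst n'; congr existT; apply/funext => j; apply: IH => //.
  by move: e => /eq_in_map/(_ j); apply; rewrite mem_enum.
elim: phi psi => [v w|i vs|phi IH|k f IH|k f IH|v phi IH|v phi IH]
    [v' w'|i' vs'|psi|k' f'|k' f'|v' psi|v' psi] //=.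
- by move=> _ _ [-> ->].
- move=> _ _ [/(pcan_inj choice.pickleK) ii' e]; subst i'; congr FRel.
  by apply/val_inj/(inj_map leaf_inj).
- by move=> fo fo' [/IH -> //].
- move=> fo fo' [/(family_inj _ _ _ _ IH fo fo')].
  by move/(congr1 (fun p : {k & index_of k -> form L} => FConj (projT2 p))).
- move=> fo fo' [/(family_inj _ _ _ _ IH fo fo')].
  by move/(congr1 (fun p : {k & index_of k -> form L} => FDisj (projT2 p))).
- by move=> fo fo' [-> /IH -> //].
- by move=> fo fo' [-> /IH -> //].
Qed.

Lemma countable_first_order (L : language) :
  countable [set phi : form L | first_order phi].
Proof.
apply/countable_injP; exists (choice.pickle \o @form_code L) => phi psi.
rewrite !in_setE => fo fo' /(pcan_inj choice.pickleK); exact: form_code_inj.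
Qed.

(** * Codes of structures and truth in a limit structure *)

(* [(k, inl s)] asks whether the [k]-th formula holds at the assignment
   [nth 0 s]; [(k, inr l)] asks whether its extension is contained in [l]. *)
Definition question : Type := (nat * (seq nat + seq (seq nat)))%type.

HB.instance Definition _ := Countable.on question.

(** Recorded witnesses keep a true existential statement from losing its witness in a limit; the [0]
    of a containment question is a dummy. *)
Definition answer (L : language) (en : nat -> form L) (x : structures L)
    (q : question) : bool * nat :=
  match q.2 with
  | inl s => (`[< sat x (en q.1) (nth 0 s) >], witness x (en q.1) (nth 0 s))
  | inr l => (`[< forall t, @extension L (en q.1) x t -> val t \in l >], 0)
  end.

Lemma closure_points_common (L : language) (en : nat -> form L)
    (S : set (structures L)) z (q r : question) :
  closure_points (answer en @` S) z ->
  exists2 x, S x & answer en x q = z q /\ answer en x r = z r.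
Proof.
move=> Sz; have [_ [x Sx <-] xz] :=
  Sz (maxn (choice.pickle q) (choice.pickle r)).+1.
by exists x => //; split; apply: xz; rewrite ltnS leq_max leqnn ?orbT.
Qed.

Lemma closure_points_sat (L : language) (en : nat -> form L)
    (S : set (structures L)) z k s m t :
  closure_points (answer en @` S) z ->
  exists x, [/\ sat x (en k) (nth 0 s) <-> (z (k, inl s)).1,
    witnessed x (en k) (nth 0 s) (z (k, inl s)).2 &
    sat x (en m) (nth 0 t) <-> (z (m, inl t)).1].
Proof.
move=> /(closure_points_common (k, inl s) (m, inl t))[x _ [<- <-]]; exists x.
split; rewrite /answer /= ?asboolE//; exact: witnessP.
Qed.

Definition limit_structure (L : language) (en : nat -> form L)
    (z : question -> bool * nat) : structures L :=
  fun i vs => `[< exists k vs0 s,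
    [/\ en k = FRel i vs0, map_tuple (nth 0 s) vs0 = vs & (z (k, inl s)).1] >].

(** A truth lemma in the manner of Henkin, by induction on the formula: each clause is checked in an
    actual structure giving the same answers for the formula and one of its parts. *)
Lemma sat_limit_structure (L : language) (en : nat -> form L)
    (S : set (structures L)) z k s :
  (forall k psi, subformulas (en k) psi -> exists m, en m = psi) ->
  closure_points (answer en @` S) z ->
  sat (limit_structure en z) (en k) (nth 0 s) <-> (z (k, inl s)).1.
Proof.
move=> en_closed Sz.
have nth_update u (v a : nat) :
    [eta nth 0 u with v |-> a] = nth 0 (set_nth 0 u v a) :> (nat -> nat).
  by apply/funext => w; rewrite nth_set_nth.
move e: (en k) => phi; elim: phi k e s =>
    [v w|i vs|psi IH|c f IH|c f IH|v psi IH|v psi IH] k e s /=.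
- by have [x [<- _ _]] := closure_points_sat k s k s Sz; rewrite e.
(* Different questions about the same tuple get the same answer, since one structure realises
   both. *)
- split=> [/asboolP[k' [vs' [s' [e' ss' zk']]]]|zk]; last first.
    by apply/asboolP; exists k, vs, s.
  have [x [<- _]] := closure_points_sat k s k' s' Sz.
  by rewrite e e' /= ss' => /iffRL; apply.
- have [m em] : exists m, en m = psi.
    by apply: (en_closed k); rewrite e; right; apply: subformulas_refl.
  have [x [<- _]] := closure_points_sat k s m s Sz.
  by rewrite (IH m)// e em /= => ->.
- have /choice[g gf] : forall j, exists m, en m = f j.
    move=> j; apply: (en_closed k); rewrite e; right.
    by exists j => //; apply: subformulas_refl.
  split=> [h|zk j]; last first.
    have [x [xk _]] := closure_points_sat k s (g j) s Sz.
    by rewrite (IH j (g j))// gf => <-; move/xk: zk; rewrite e; apply.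
  apply: contrapT => nzk.
  (* The structure [x] only reveals the index [j] coded by the witness. Once [j] is known, [y]
     matches [z] on the formula and on [f j], and its failing index is again [j]. *)
  have [x [xk + _]] := closure_points_sat k s k s Sz.
  rewrite e /= in xk *; case=> [/xk//|[j jw _]].
  have [y [yk + yj]] := closure_points_sat k s (g j) s Sz.
  rewrite e /= in yk *; case=> [/yk//|[j' j'w nj']]; apply: nj'.
  have -> : j' = j by apply: index_code_inj; rewrite jw.
  by rewrite -gf; apply/yj/IH.
- have /choice[g gf] : forall j, exists m, en m = f j.
    move=> j; apply: (en_closed k); rewrite e; right.
    by exists j => //; apply: subformulas_refl.
  split=> [[j]|zk].
    have [x [<- _]] := closure_points_sat k s (g j) s Sz.
    by rewrite (IH j (g j))// gf e => <-; exists j.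
  have [x [xk + _]] := closure_points_sat k s k s Sz.
  rewrite e /= in xk *; case=> [/xk//|[j jw _]].
  have [y [yk + yj]] := closure_points_sat k s (g j) s Sz.
  rewrite e /= in yk *; case=> [/yk//|[j' j'w fj']]; exists j.
  have jj' : j' = j by apply: index_code_inj; rewrite jw.
  by apply/(IH j (g j) (gf j))/yj; rewrite gf -jj'.
- have [m em] : exists m, en m = psi.
    by apply: (en_closed k); rewrite e; right; apply: subformulas_refl.
  split=> [[a]|zk].
    have [x [<- _]] := closure_points_sat k s m (set_nth 0 s v a) Sz.
    by rewrite nth_update (IH m)// em e => <-; exists a; rewrite nth_update.
  (* Here the witness can be read off [z] directly, so a single structure suffices. *)
  set w := (z (k, inl s)).2; exists w.
  have [x [xk + xm]] := closure_points_sat k s m (set_nth 0 s v w) Sz.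
  rewrite e /= -/w in xk *; case=> [/xk//|].
  by rewrite !nth_update (IH m)// -xm em.
- have [m em] : exists m, en m = psi.
    by apply: (en_closed k); rewrite e; right; apply: subformulas_refl.
  split=> [h|zk a]; last first.
    have [x [xk _]] := closure_points_sat k s m (set_nth 0 s v a) Sz.
    rewrite nth_update (IH m)// em => <-; rewrite -nth_update.
    by move/xk: zk; rewrite e; apply.
  apply: contrapT => nzk; set w := (z (k, inl s)).2.
  have [x [xk + xm]] := closure_points_sat k s m (set_nth 0 s v w) Sz.
  rewrite e /= -/w in xk *; case=> [/xk//|]; apply.
  by rewrite nth_update -em; apply/xm/(IH m); rewrite // -nth_update.
Qed.

(** * Openness of separability *)

Lemma few_vs_many_limit_structure (L : language) (en : nat -> form L)
    (S : set (structures L)) x y k :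
  (forall k psi, subformulas (en k) psi -> exists m, en m = psi) ->
  few_vs_many (@extension L (en k) x) (@extension L (en k) y) ->
  exists n, forall z w,
    closure_points (answer en @` S) z -> closure_points (answer en @` S) w ->
    agree n (answer en x) z -> agree n (answer en y) w ->
    few_vs_many (@extension L (en k) (limit_structure en z))
                (@extension L (en k) (limit_structure en w)).
Proof.
move=> en_closed [l [l' [ul' ll' xl l'y]]].
have /choice[c cE] (t : (size (free_var_seq (en k))).-tuple nat) :
    exists s, assignment (en k) t = nth 0 s.
  by apply: assignment_nth; rewrite size_tuple.
have extE u t : @extension L (en k) u t <-> sat u (en k) (nth 0 (c t)).
  by rewrite -cE.
(* The certificate is fixed by one containment question for [x] and one satisfaction question for
   [y] per entry of [l']. *)
pose q0 : question := (k, inr (map val l)).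
pose q t : question := (k, inl (c t)).
exists (maxn (choice.pickle q0) (\max_(t <- l') choice.pickle (q t))).+1.
move=> z w Sz Sw xz yw; exists l, l'; split=> // t.
  move=> /extE /(sat_limit_structure _ _ en_closed Sz) zt.
  (* The structure [u] answers [q0] and [q t] as [z] does: its extension lies in [l] and contains
     [t]. *)
  have [u _ [u0 ut]] := closure_points_common q0 (q t) Sz.
  have : (answer en u q0).1.
    rewrite u0 -xz ?ltnS ?leq_maxl//; apply/asboolP => r /xl lr.
    by rewrite mem_map//; apply: val_inj.
  move=> /asboolP /= /(_ t); rewrite mem_map; last exact: val_inj.
  by apply; apply/extE; move: zt; rewrite -ut => /asboolP.
move=> /= lt; apply/extE/(sat_limit_structure _ _ en_closed Sw).
rewrite -[(k, _)]/(q t) -yw; first by apply/asboolP/extE/l'y.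
rewrite ltnS leq_max; apply/orP; right.
exact: (@leq_bigmax_seq _ _ xpredT (fun t => choice.pickle (q t))).
Qed.

Lemma separable_neq (L : language) (F : set (form L)) x y :
  separable F x y -> x <> y.
Proof. by move=> [phi _ neq] xy; apply: neq; rewrite xy; apply: card_eqxx. Qed.

Lemma separable_sym (L : language) (F : set (form L)) x y :
  separable F x y -> separable F y x.
Proof. by move=> [phi Fphi neq]; exists phi => //; rewrite card_eq_sym. Qed.

Lemma separable_limit_structure (L : language) (en : nat -> form L)
    (F : set (form L)) (S : set (structures L)) x y :
  (forall k psi, subformulas (en k) psi -> exists m, en m = psi) ->
  F `<=` range en -> separable F x y ->
  exists n, forall z w,
    closure_points (answer en @` S) z -> closure_points (answer en @` S) w ->
    agree n (answer en x) z -> agree n (answer en y) w ->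
    separable F (limit_structure en z) (limit_structure en w).
Proof.
move=> en_closed Fen [phi Fphi neq]; have [k _ ek] := Fen _ Fphi; subst phi.
have [/(few_vs_many_limit_structure S en_closed)[n nP]|] := neq_few_vs_many neq.
  by exists n => z w Sz Sw xz yw; exists (en k) => //; apply/few_vs_many_neq/nP.
move=> /(few_vs_many_limit_structure S en_closed)[n nP].
exists n => z w Sz Sw xz yw; apply: separable_sym; exists (en k) => //.
exact/few_vs_many_neq/nP.
Qed.

(** * Continuum many models along the Cantor scheme *)

Lemma countable_enumeration (U : Type) (A : set U) a :
  A a -> countable A -> exists en : nat -> U, range en = A.
Proof.
move=> Aa /countable_injP[f f_inj].
have /choice[g gP] n : exists u, A u /\ ((exists2 v, A v & f v = n) -> f u = n).
  have [[v Av vn]|no] := pselect (exists2 v, A v & f v = n); first by exists v.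
  by exists a; split=> // /no.
exists g; apply/seteqP; split=> [_ [n _ <-]|v Av]; first by have [] := gP n.
exists (f v) => //; have [Ag gf] := gP (f v).
by apply: f_inj; rewrite ?in_setE//; apply: gf; exists v.
Qed.

Theorem corollary0p3 (L : language) (L_nonempty : inhabited (symb L))
    (T F : set (form L)) (T_fo : first_order_theory T)
    (F_fragment : fragment F) (F_countable : countable F) :
  (exists S : set (structures L),
     [/\ S `<=` [set x | models x T], ~ countable S
       & pairwise_on (separable F) S]) ->
  (exists S : set (structures L),
     [/\ S `<=` [set x | models x T], continuum_sized S
       & pairwise_on (separable F) S]) /\
  (exists S : set (structures L),
     [/\ S `<=` [set x | models x T], continuum_sized S
       & pairwise_on (fun x y => ~ isomorphic x y) S]).
Proof.
move=> [S [ST uS sepS]].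
(* The first-order formulas are added so that the sentences of [T] are among those that codes
   decide. *)
have [en enE] : exists en : nat -> form L,
    range en = F `|` [set phi | first_order phi].
  apply: (@countable_enumeration _ _ (FEq 0 0)); first by right.
  exact: countable_setU F_countable (countable_first_order L).
have en_closed k psi : subformulas (en k) psi -> exists m, en m = psi.
  move=> sub; suff [m _ <-] : range en psi by exists m.
  have : range en (en k) by exists k.
  rewrite enE => -[/(fragment_sub F_fragment)/(_ _ sub)|]; first by left.
  by move=> /first_order_subformulas/(_ _ sub); right.
have Fen : F `<=` range en by rewrite enE => phi; left.
have openS x y : S x -> S y -> x <> y -> exists n, forall z w,
    closure_points (answer en @` S) z -> closure_points (answer en @` S) w ->
    agree n (answer en x) z -> agree n (answer en y) w ->
    separable F (limit_structure en z) (limit_structure en w).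
  by move=> Sx Sy xy; apply: separable_limit_structure => //; apply: sepS.
have limS x : S x -> closure_points (answer en @` S) (answer en x).
  by move=> Sx n; exists (answer en x) => //; exists x.
have answer_inj : {in S &, injective (answer en)}.
  (* If distinct [x] and [y] had one code, openness applied to that code twice would separate a
     limit structure from itself. *)
  move=> x y; rewrite !in_setE => Sx Sy xy; apply: contrapT => /(openS _ _ Sx Sy).
  move=> [n /(_ (answer en x) (answer en x))] sep.
  by apply: (separable_neq (sep _ _ _ _)) => //; rewrite -?xy//; apply: limS.
have [h [hS sep_h]] : exists h : (nat -> bool) -> (question -> bool * nat),
    (forall b, closure_points (answer en @` S) (h b)) /\ forall b c, b <> c ->
      separable F (limit_structure en (h b)) (limit_structure en (h c)).
  apply: (@perfect_set _ _ _ (fun z w =>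
    separable F (limit_structure en z) (limit_structure en w))).
  - apply: contra_not uS; apply: sub_countable.
    by have := inj_card_eq answer_inj; rewrite card_eq_le => /andP[].
  - by move=> z w; apply: separable_sym.
  - move=> _ _ [x Sx <-] [y Sy <-] xy; apply: openS => // e.
    by apply: xy; rewrite e.
pose model b := limit_structure en (h b).
have modelT b : models (model b) T.
  move=> phi Tphi e; have [fo closed_phi] := T_fo _ Tphi.
  have [k _ ek] : range en phi by rewrite enE; right.
  (* A sentence does not depend on the assignment, so the zero assignment, coded by the empty
     sequence, may be used. *)
  apply/(@sat_ext _ _ _ _ (nth 0 [::])); first by rewrite closed_phi.
  rewrite -ek; apply/(sat_limit_structure k [::] en_closed (hS b)).
  have [x Sx [<- _]] := closure_points_common (k, inl [::]) (k, inl [::]) (hS b).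
  by apply/asboolP; rewrite /= ek; apply: ST.
have model_inj : {in [set: nat -> bool] &, injective model}.
  by move=> b c _ _ bc; apply: contrapT => /sep_h/separable_neq.
have model_sep : pairwise_on (separable F) (range model).
  by move=> _ _ [b _ <-] [c _ <-] bc; apply: sep_h => e; apply: bc; rewrite e.
have modelsT : range model `<=` [set x | models x T].
  by move=> _ [b _ <-]; apply: modelT.
have model_card : continuum_sized (range model) := inj_card_eq model_inj.
split; exists (range model); split=> // x y xM yM xy iso.
have [phi Fphi] := model_sep _ _ xM yM xy; apply.
by apply: isomorphic_extension iso; apply: (fragment_Lw1w F_fragment).
Qed.
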